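(* Let $A,B$ be topological Abelian groups. The map $$E^{ws}_{\mathbf{TA}}(A,B)\to \mathcal{Z}_c(A,B)/\mathcal{B}_c(A,B),\qquad [E]\mapsto[f_E],$$ is well defined, and it is an isomorphism of Abelian groups $$E^{ws}_{\mathbf{TA}}(A,B)\cong\mathcal{Z}_c(A,B)/\mathcal{B}_c(A,B),$$ where $E^{ws}_{\mathbf{TA}}(A,B)$ is provided with the Baer sum, and the sum in $\mathcal{Z}_c(A,B)/\mathcal{B}_c(A,B)$ is induced by the sum in $B$.
   Context: $\mathbf{TA}$ is the category of topological Abelian groups (not assumed Hausdorff) and continuous homomorphisms. An extension of $B$ by $A$ in $\mathbf{TA}$ is a sequence $E=(B\xrightarrow{\alpha}X\xrightarrow{\beta}A)$ in $\mathbf{TA}$ where $\beta$ is a surjective open continuous homomorphism and $\alpha$ is the kernel of $\beta$ in $\mathbf{TA}$ (i.e. $\alpha$ is a topological embedding with image $\beta^{-1}(0)$). It is a weak-split extension ($ws$-extension) if there is a continuous map $\mathbf{s}\colon A\to X$ (not necessarily a homomorphism) with $\beta\mathbf{s}=\mathrm{id}_A$ and $\mathbf{s}(0)=0$ (a continuous pointed section). $E^{ws}_{\mathbf{TA}}(A,B)$ is the set of $ws$-extensions of $B$ by $A$ modulo the equivalence relation generated by: $(B\xrightarrow{\alpha}X\xrightarrow{\beta}A)\sim(B\xrightarrow{\alpha'}X'\xrightarrow{\beta'}A)$ if there is a continuous homomorphism $\theta\colon X\to X'$ with $\theta\alpha=\alpha'$ and $\beta'\theta=\beta$. The Baer sum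 is $[E]+[E']=[\Delta_A^*((\nabla^B)_*(E\times E'))]$, where $E\times E'$ is the product extension of $B\times B$ by $A\times A$, $(\nabla^B)_*$ is pushout in $\mathbf{TA}$ along $\nabla^B(b,b')=b+b'$, and $\Delta_A^*$ is pullback along $\Delta_A(a)=(a,a)$. $\mathcal{Z}_c(A,B)$ is the group (under pointwise sum in $B$) of continuous maps $f\colon A\times A\to B$ with $f(0,0)=0$ such that $f(a,a')=f(a',a)$ and $f(a,a')+f(a+a',a'')=f(a,a'+a'')+f(a',a'')$ for all $a,a',a''\in A$. $\mathcal{B}_c(A,B)$ is the subgroup of those $f\in\mathcal{Z}_c(A,B)$ for which there is a continuous map $h\colon A\to B$ with $h(0)=0$ and $f(a,a')=h(a)+h(a')-h(a+a')$ for all $a,a'\in A$. For a $ws$-extension $E=(B\xrightarrow{\alpha}X\xrightarrow{\beta}A)$, pick a continuous pointed section $\mathbf{s}$ of $\beta$, let $\mathbf{r}=\alpha^{-1}(\mathrm{id}_X-\mathbf{s}\beta)\colon X\to B$ be the associated continuous retraction, and set $f_E(a,a')=\mathbf{r}(\mathbf{s}(a)+\mathbf{s}(a')-\mathbf{s}(a+a'))$. *)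

(* Defs.v *)
From HB Require Import structures.
From Stdlib Require Import Relation_Operators.
From mathcomp Require Import all_boot all_algebra all_classical all_reals.
From mathcomp Require Import topology tvs.

Set Implicit Arguments.
Unset Strict Implicit.
Unset Printing Implicit Defensive.

Import GRing.Theory.
Local Open Scope classical_set_scope.
Local Open Scope ring_scope.
Local Open Scope quotient_scope.

Section continuity.
Variables (T U V : topologicalType).

Lemma continuous_pair (f : T -> U) (g : T -> V) :
  continuous f -> continuous g -> continuous (fun x => (f x, g x)).
Proof. by move=> cf cg x; apply: cvg_pair; [exact: cf|exact: cg]. Qed.

Lemma continuous_o (g : U -> V) (f : T -> U) :
  continuous g -> continuous f -> continuous (g \o f).
Proof. by move=> cg cf x; apply: continuous_comp; [exact: cf|exact: cg]. Qed.

Lemma continuous_fst : continuous (fst : U * V -> U).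
Proof. by move=> x; exact: cvg_fst. Qed.

Lemma continuous_snd : continuous (snd : U * V -> V).
Proof. by move=> x; exact: cvg_snd. Qed.

End continuity.

Lemma continuousB (T : topologicalType) (G : topologicalZmodType)
    (f g : T -> G) :
  continuous f -> continuous g -> continuous (fun x => f x - g x).
Proof.
move=> cf cg; exact: (@continuous_o _ _ _ (fun q : G * G => q.1 - q.2)
  (fun x => (f x, g x)) (@sub_continuous G) (continuous_pair cf cg)).
Qed.


Lemma continuousD (T : topologicalType) (G : topologicalZmodType)
    (f g : T -> G) :
  continuous f -> continuous g -> continuous (fun x => f x + g x).
Proof.
move=> cf cg; exact: (@continuous_o _ _ _ (fun q : G * G => q.1 + q.2)
  (fun x => (f x, g x)) (@add_continuous G) (continuous_pair cf cg)).
Qed.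

#[short(type="contAdditiveType")]
HB.structure Definition ContAdditive (G H : topologicalZmodType) :=
  {f of @Continuous G H f & @GRing.Additive G H f}.

(* An alias of the product type: the library attaches its topologicalZmodType
   instance on [prod] to locally convex spaces only. *)
Definition tprod (G H : Type) : Type := (G * H)%type.

Section tprod.
Variables (G H : topologicalZmodType).

HB.instance Definition _ := GRing.Zmodule.copy (tprod G H) (G * H)%type.
HB.instance Definition _ := Topological.copy (tprod G H) (G * H)%type.

Let tprod_sub_continuous :
  continuous (fun p : tprod G H * tprod G H => p.1 - p.2).
Proof.
apply: (@continuous_pair _ _ _
  (fun p : (G * H) * (G * H) => p.1.1 - p.2.1) (fun p => p.1.2 - p.2.2)).
- apply: continuousB.
    exact: (continuous_o (@continuous_fst G H) (@continuous_fst _ _)).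
  exact: (continuous_o (@continuous_fst G H) (@continuous_snd _ _)).
- apply: continuousB.
    exact: (continuous_o (@continuous_snd G H) (@continuous_fst _ _)).
  exact: (continuous_o (@continuous_snd G H) (@continuous_snd _ _)).
Qed.

HB.instance Definition _ :=
  PreTopologicalNmodule_isTopologicalZmodule.Build (tprod G H)
    tprod_sub_continuous.

End tprod.

Section tsub.
Variables (G : topologicalZmodType) (S : zmodClosed G).

Definition tsub : Type := {x : G | x \in S}.

HB.instance Definition _ := SubChoice.on tsub.
HB.instance Definition _ := [SubChoice_isSubZmodule of tsub by <:].
HB.instance Definition _ :=
  Topological.copy tsub (initial_topology (val : tsub -> G)).

Lemma tsub_nbhs (x : tsub) (U : set tsub) : nbhs x U ->
  exists2 W, nbhs (val x) W & val @^-1` W `<=` U.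
Proof.
rewrite nbhsE => -[_ [[W oW <-] Wx] WU]; exists W => //.
exact: open_nbhs_nbhs.
Qed.

Lemma tsub_val_continuous : continuous (val : tsub -> G).
Proof. exact: initial_continuous. Qed.

Lemma continuous_tsub (T : topologicalType) (f : T -> tsub) :
  continuous (fun x => val (f x)) -> continuous f.
Proof. exact: (@continuous_comp_initial tsub). Qed.

Let tsub_sub_continuous : continuous (fun p : tsub * tsub => p.1 - p.2).
Proof.
apply: continuous_tsub.
have -> : (fun p : tsub * tsub => val (p.1 - p.2)) =
    (fun p : tsub * tsub => val p.1 - val p.2).
  by apply/funext => p; rewrite raddfB.
apply: continuousB.
  exact: (continuous_o tsub_val_continuous (@continuous_fst _ _)).
exact: (continuous_o tsub_val_continuous (@continuous_snd _ _)).
Qed.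

HB.instance Definition _ :=
  PreTopologicalNmodule_isTopologicalZmodule.Build tsub tsub_sub_continuous.

End tsub.

Section tquot.
Variables (G : topologicalZmodType) (N : zmodClosed G).

Definition tquot : Type := quotient_topology (Quotient.quot N).

HB.instance Definition _ := Topological.on tquot.
HB.instance Definition _ := Quotient.on tquot.
HB.instance Definition _ := GRing.isZmodule.Build tquot
  (@Quotient.addqA G N) (@Quotient.addqC G N) (@Quotient.add0q G N)
  (@Quotient.addNq G N).

Lemma tquot_pi_eq (x y : G) : (\pi_tquot x = \pi_tquot y) <-> (x - y \in N).
Proof.
rewrite Quotient.idealrBE; split; first by move=> e; apply/eqP.
by move=> /eqP.
Qed.

Lemma tquot_pi_continuous : continuous (\pi_tquot : G -> tquot).
Proof. exact: pi_continuous. Qed.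

Lemma tquot_piB : {morph (\pi_tquot : G -> tquot) : x y / x - y}.
Proof.
by move=> x y; exact: (raddfB (\pi_(Quotient.quot N))).
Qed.

Lemma tquot_pi_open (U : set G) : open U -> open (\pi_tquot @` U).
Proof.
move=> oU; rewrite /open/= /quotient_open.
rewrite (_ : _ @^-1` _ = \bigcup_(n in [set` N]) ((fun x => x - n) @^-1` U)).
  apply: bigcup_open => n _; apply: open_comp => // x _.
  by apply: continuousB; [move=> ?; exact: cvg_id|move=> ?; exact: cvg_cst].
apply/seteqP; split=> [x [u Uu ux]|x [n Nn Ux]] /=.
  exists (x - u) => /=; last by rewrite opprB addrCA subrr addr0.
  by apply/tquot_pi_eq.
exists (x - n) => //; apply/tquot_pi_eq.
by rewrite addrAC subrr add0r rpredN.
Qed.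

Let tquot_sub_continuous : continuous (fun p : tquot * tquot => p.1 - p.2).
Proof.
have piN (x : G) (V : set G) : nbhs x V ->
    nbhs (\pi_tquot x : tquot) (\pi_tquot @` V).
  rewrite nbhsE => -[W [oW Wx] WV]; rewrite nbhsE.
  exists (\pi_tquot @` W); last exact: image_subset.
  by split; [exact: tquot_pi_open|exists x].
move=> [p q]; rewrite -[p]reprK -[q]reprK; move: (repr p) (repr q) => x y U.
rewrite /= -tquot_piB => xyU.
have [[V W] /= [Vx Wy] VWU] := @sub_continuous G (x, y) _
  (tquot_pi_continuous xyU).
exists (\pi_tquot @` V, \pi_tquot @` W) => /=; first by split; exact: piN.
move=> [_ _] /= [[v Vv <-] [w Ww <-]].
by rewrite -tquot_piB; exact: (VWU (v, w)).
Qed.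

HB.instance Definition _ :=
  PreTopologicalNmodule_isTopologicalZmodule.Build tquot tquot_sub_continuous.

End tquot.


Section extension.
Variables A B : topologicalZmodType.

Record extension := Extension {
  ext_mid : topologicalZmodType ;
  ext_in : contAdditiveType B ext_mid ;
  ext_pr : contAdditiveType ext_mid A ;
  ext_pr_surj : forall a, exists x, ext_pr x = a ;
  ext_pr_open : forall U, open U -> open (ext_pr @` U) ;
  ext_in_inj : injective ext_in ;
  (* the topology of B is the one induced by ext_in *)
  ext_in_embed : open = wopen ext_in ;
  ext_exact : range ext_in = ext_pr @^-1` [set 0]
}.

Definition pointed_section (E : extension) (s : A -> ext_mid E) : Prop :=
  [/\ continuous s, cancel s (ext_pr E) & s 0 = 0].

Record ws_extension := WsExtension {
  ws_ext :> extension ;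
  ws_split : exists s, @pointed_section ws_ext s
}.

Definition ext_le (E F : ws_extension) : Prop :=
  exists theta : contAdditiveType (ext_mid E) (ext_mid F),
    (forall b, theta (ext_in E b) = ext_in F b) /\
    (forall x, ext_pr F (theta x) = ext_pr E x).

Definition ws_equiv : ws_extension -> ws_extension -> Prop :=
  clos_refl_sym_trans ws_extension ext_le.

(* The quotient is the type of equivalence classes, built by hand:
   [ws_extension] quantifies over all topologicalZmodTypes, and universe
   constraints forbid a choiceType (hence {eq_quot _} or zmodType) structure on
   it or on its quotient. *)
Definition Ews : Type :=
  {C : ws_extension -> Prop | exists E, C = ws_equiv E}.

Definition ws_class (E : ws_extension) : Ews :=
  exist _ (ws_equiv E) (ex_intro _ E erefl).

Lemma ws_class_surj (c : Ews) : exists E, ws_class E = c.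
Proof.
case: c => C CE; have [E CEE] := CE; exists E; rewrite /ws_class.
by subst C; congr exist; exact: Prop_irrelevance.
Qed.

Lemma ws_classP (E F : ws_extension) :
  ws_class E = ws_class F <-> ws_equiv E F.
Proof.
split=> [/(congr1 sval) /= ->|EF]; first exact: rst_refl.
have e : ws_equiv E = ws_equiv F.
  apply/funext => D; apply/propext; split=> ?.
    by apply: rst_trans (rst_sym _ _ _ _ EF) _.
  by apply: rst_trans EF _.
rewrite /ws_class; move: (ex_intro _ E _) (ex_intro _ F _); rewrite e => p q.
by congr exist; exact: Prop_irrelevance.
Qed.

Definition ws_repr (c : Ews) : ws_extension := projT1 (cid (ws_class_surj c)).

Lemma ws_reprK (c : Ews) : ws_class (ws_repr c) = c.
Proof. exact: projT2 (cid (ws_class_surj c)). Qed.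

End extension.

Lemma ext_pr_eq0P (A B : topologicalZmodType) (E : extension A B)
    (x : ext_mid E) :
  ext_pr E x = 0 <-> exists b, ext_in E b = x.
Proof.
have -> : (ext_pr E x = 0) = range (ext_in E) x by rewrite ext_exact.
by split=> [[b _ <-]|[b <-]]; exists b.
Qed.

Lemma ext_pr_in (A B : topologicalZmodType) (E : extension A B) b :
  ext_pr E (ext_in E b) = 0.
Proof. by apply/ext_pr_eq0P; exists b. Qed.

Lemma open_mapP (T U : topologicalType) (f : T -> U) :
  (forall V, open V -> open (f @` V)) <->
  (forall x V, nbhs x V -> nbhs (f x) (f @` V)).
Proof.
split=> [fo x V|fn V oV].
  rewrite nbhsE => -[W [oW Wx] WV]; rewrite nbhsE.
  by exists (f @` W); [split; [exact: fo|exists x]|exact: image_subset].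
rewrite openE => _ [x Vx <-]; apply: fn.
by apply: open_nbhs_nbhs; split.
Qed.

Lemma open_wopenP (T U : topologicalType) (f : T -> U) : continuous f ->
  (open = wopen f) <->
  (forall x V, nbhs x V -> exists2 W, nbhs (f x) W & f @^-1` W `<=` V).
Proof.
move=> cf; split=> [fw x V|fn].
  rewrite nbhsE => -[W [oW Wx] WV]; move: oW; rewrite fw => -[D oD DW].
  exists D; last by rewrite DW.
  by apply: open_nbhs_nbhs; split => //; move: Wx; rewrite -DW.
apply/seteqP; split=> V; last by move=> [W oW <-]; move/continuousP: cf; apply.
move=> oV; exists (\bigcup_(W in [set W | open W /\ f @^-1` W `<=` V]) W).
  by apply: bigcup_open => W [].
apply/seteqP; split=> [x [W [_ WV] Wx]|x Vx]; first exact: WV.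
have [|W] := fn x V; first by apply: open_nbhs_nbhs; split.
rewrite nbhsE => -[D [oD Dx] DW] WV; exists D => //; split=> //.
by move=> y Dy; apply: WV; exact: DW.
Qed.

Lemma ext_in_nbhs (A B : topologicalZmodType) (E : extension A B) b V :
  nbhs b V -> exists2 W, nbhs (ext_in E b) W & ext_in E @^-1` W `<=` V.
Proof.
exact: (open_wopenP (@cts_fun _ _ (ext_in E))).1 (ext_in_embed E) b V.
Qed.

Section tprod_map.
Variables (G H G' H' : topologicalZmodType).
Variables (f : contAdditiveType G G') (g : contAdditiveType H H').

Definition tprod_map (p : tprod G H) : tprod G' H' := (f p.1, g p.2).

Let tprod_map_continuous : continuous tprod_map.
Proof.
apply: (@continuous_pair _ _ _ (fun p : G * H => f p.1) (fun p => g p.2)).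
  exact: (continuous_o (@cts_fun _ _ f) (@continuous_fst _ _)).
exact: (continuous_o (@cts_fun _ _ g) (@continuous_snd _ _)).
Qed.

Let tprod_map_additive : zmod_morphism tprod_map.
Proof. by move=> p q; rewrite /tprod_map !raddfB. Qed.

HB.instance Definition _ := isContinuous.Build _ _ tprod_map
  tprod_map_continuous.
HB.instance Definition _ := GRing.isZmodMorphism.Build _ _ tprod_map
  tprod_map_additive.

End tprod_map.

Section ext_prod.
Variables (A B A' B' : topologicalZmodType).
Variables (E : extension A B) (E' : extension A' B').

Local Notation pin := (tprod_map (ext_in E) (ext_in E')).
Local Notation ppr := (tprod_map (ext_pr E) (ext_pr E')).

Let ppr_surj a : exists x, ppr x = a.
Proof.
case: a => a a'; have [x xa] := ext_pr_surj E a.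
by have [x' xa'] := ext_pr_surj E' a'; exists (x, x'); rewrite /tprod_map xa xa'.
Qed.

Let ppr_open U : open U -> open (ppr @` U).
Proof.
move: U; apply/open_mapP => -[x x'] U [[V V'] /= [Vx Vx'] VU].
exists (ext_pr E @` V, ext_pr E' @` V') => /=.
  split; [move: Vx|move: Vx'].
    exact: (open_mapP (ext_pr E)).1 (@ext_pr_open _ _ E) x V.
  exact: (open_mapP (ext_pr E')).1 (@ext_pr_open _ _ E') x' V'.
move=> [_ _] /= [[y Vy <-] [y' Vy' <-]].
by exists (y, y') => //; exact: (VU (y, y')).
Qed.

Let pin_inj : injective pin.
Proof.
by move=> [b b'] [c c'] [] /ext_in_inj -> /ext_in_inj ->.
Qed.

Let pin_embed : open = wopen pin.
Proof.
apply/open_wopenP; first exact: cts_fun.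
move=> [b b'] U [[V V'] /= [Vb Vb'] VU].
have [W Wb WV] :=
  @ext_in_nbhs _ _ E b V Vb.
have [W' Wb' WV'] :=
  @ext_in_nbhs _ _ E' b' V' Vb'.
exists (W `*` W'); first by exists (W, W').
move=> [c c'] /= [Wc Wc']; apply: (VU (c, c')).
by split; [exact: WV|exact: WV'].
Qed.

Let pexact : range pin = ppr @^-1` [set 0].
Proof.
apply/seteqP; split=> [_ [[b b'] _ <-]|[x x'] [/ext_pr_eq0P[b <-]]].
  by congr pair; exact: ext_pr_in.
by move=> /ext_pr_eq0P[b' <-]; exists (b, b').
Qed.

Definition ext_prod : extension (tprod A A') (tprod B B') :=
  Extension ppr_surj ppr_open pin_inj pin_embed pexact.

End ext_prod.

Section pushout.
Variables (A B B' : topologicalZmodType) (E : extension A B).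
Variable g : contAdditiveType B B'.

(* The pushout is (B' x X) / {(g b, - ext_in b)} with the quotient topology. *)
Definition po_rel : {pred tprod B' (ext_mid E)} :=
  [pred p | `[< exists b, p = (g b, - ext_in E b) >]].

Let po_rel_zmod_closed : zmod_closed po_rel.
Proof.
split=> [|p q].
  by apply/asboolP; exists 0; rewrite !raddf0.
move=> /asboolP[b ->] /asboolP[c ->]; apply/asboolP; exists (b - c).
by rewrite !raddfB.
Qed.

HB.instance Definition _ := GRing.isZmodClosed.Build _ po_rel
  po_rel_zmod_closed.

Local Notation Q := (tquot po_rel).

Definition po_in (b : B') : Q := \pi_Q (b, 0).

Let po_in_continuous : continuous po_in.
Proof.
apply: (@continuous_o _ _ _ (\pi_Q : tprod B' (ext_mid E) -> Q)
  (fun b => (b, 0))).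
  exact: tquot_pi_continuous.
by apply: continuous_pair; [move=> ?; exact: cvg_id|move=> ?; exact: cvg_cst].
Qed.

Let po_in_additive : zmod_morphism po_in.
Proof.
move=> b c; rewrite /po_in -tquot_piB; congr (\pi_Q _).
by congr pair; rewrite subr0.
Qed.

HB.instance Definition _ := isContinuous.Build _ _ po_in po_in_continuous.
HB.instance Definition _ := GRing.isZmodMorphism.Build _ _ po_in
  po_in_additive.

Definition po_pr (q : Q) : A := ext_pr E (repr q).2.

Lemma po_prE p : po_pr (\pi_Q p) = ext_pr E p.2.
Proof.
have /tquot_pi_eq/asboolP[b e] :
  \pi_Q (repr (\pi_Q p)) = \pi_Q p := reprK (\pi_Q p).
apply/eqP; rewrite -subr_eq0 -raddfB.
rewrite -[_.2 - _]/((repr (\pi_Q p) - p).2) e /=.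
by rewrite raddfN oppr_eq0; apply/eqP; exact: ext_pr_in.
Qed.

Let po_pr_continuous : continuous po_pr.
Proof.
apply/quotient_continuous.
have -> : po_pr \o \pi_Q = (fun p => ext_pr E p.2).
  by apply/funext => p; exact: po_prE.
exact: (continuous_o (@cts_fun _ _ (ext_pr E)) (@continuous_snd _ _)).
Qed.

Let po_pr_additive : zmod_morphism po_pr.
Proof.
move=> p q; rewrite -[p]reprK -[q]reprK -tquot_piB !po_prE.
exact: raddfB.
Qed.

HB.instance Definition _ := isContinuous.Build _ _ po_pr po_pr_continuous.
HB.instance Definition _ := GRing.isZmodMorphism.Build _ _ po_pr
  po_pr_additive.

Let po_pr_surj a : exists q, po_pr q = a.
Proof.
by have [x <-] := ext_pr_surj E a; exists (\pi_Q (0, x)); rewrite po_prE.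
Qed.

Let po_pr_open U : open U -> open (po_pr @` U).
Proof.
move=> oU; have oV : open (\pi_Q @^-1` U) := oU.
rewrite (_ : _ @` _ = ext_pr E @` (snd @` (\pi_Q @^-1` U))).
  by apply: ext_pr_open; exact: (@snd_open B' (ext_mid E)).
apply/seteqP; split=> [_ [q Uq <-]|_ [_ [p Up <-] <-]].
  by exists (repr q).2 => //; exists (repr q) => //=; rewrite reprK.
by exists (\pi_Q p) => //; exact: po_prE.
Qed.

Let po_in_inj : injective po_in.
Proof.
move=> b c /tquot_pi_eq/asboolP[d [bc]]; rewrite subr0 => /eqP.
rewrite eq_sym oppr_eq0 -(raddf0 (ext_in E)) => /eqP/ext_in_inj d0.
by apply/eqP; rewrite -subr_eq0 bc d0 raddf0.
Qed.

Let po_in_embed : open = wopen po_in.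
Proof.
apply/open_wopenP => [|b U Ub]; first exact: cts_fun.
have [[W1 W2] /= [W1b W20] WU] : nbhs ((b, 0) : B' * B') [set p : B' * B' | U (p.1 + p.2)].
  by apply: (@add_continuous B' (b, 0)) => /=; rewrite addr0.
have gW : nbhs (0 : B) (g @^-1` W2).
  by apply: cts_fun; move: W20; rewrite -(raddf0 g).
have [V V0 VW] :=
  @ext_in_nbhs _ _ E 0 _ gW.
exists (\pi_Q @` (W1 `*` V)).
  apply: ((open_mapP _).1 (@tquot_pi_open _ po_rel)).
  by exists (W1, V) => //; split=> //=; move: V0; rewrite (raddf0 (ext_in E)).
move=> c [[w v] /= [W1w Vv] /esym/tquot_pi_eq/asboolP[d [/= cw]]].
rewrite sub0r => /oppr_inj vd.
have -> : c = w + g d by rewrite -cw addrC subrK.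
by apply: (WU (w, g d)); split=> //=; apply: VW; rewrite /= -vd.
Qed.

Let po_exact : range po_in = po_pr @^-1` [set 0].
Proof.
apply/seteqP; split=> [_ [b _ <-]|q] /=; first by rewrite po_prE raddf0.
rewrite -[q]reprK po_prE; case: (repr q) => b x /= /ext_pr_eq0P[d <-].
exists (b + g d) => //; apply/tquot_pi_eq/asboolP; exists d.
by congr pair => /=; [rewrite addrAC subrr add0r|rewrite sub0r].
Qed.

Definition pushout : extension A B' :=
  Extension po_pr_surj po_pr_open po_in_inj po_in_embed po_exact.

End pushout.

Section pullback.
Variables (A A' B : topologicalZmodType) (E : extension A B).
Variable h : contAdditiveType A' A.

Definition pb_rel : {pred tprod A' (ext_mid E)} :=
  [pred p | h p.1 == ext_pr E p.2].

Let pb_rel_zmod_closed : zmod_closed pb_rel.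
Proof.
split=> [|p q]; first by rewrite inE !raddf0.
rewrite !inE => /eqP hp /eqP hq; apply/eqP.
rewrite -[(p - q).1]/(p.1 - q.1) -[(p - q).2]/(p.2 - q.2) !raddfB.
by congr (_ - _).
Qed.

HB.instance Definition _ := GRing.isZmodClosed.Build _ pb_rel
  pb_rel_zmod_closed.

Local Notation P := (tsub pb_rel).

Lemma pb_in_mem (b : B) : (0, ext_in E b) \in pb_rel.
Proof. by rewrite inE raddf0 ext_pr_in. Qed.

Definition pb_in (b : B) : P := exist _ (0, ext_in E b) (pb_in_mem b).

Let pb_in_continuous : continuous pb_in.
Proof.
apply: continuous_tsub; apply: continuous_pair; last exact: cts_fun.
by move=> ?; exact: cvg_cst.
Qed.

Let pb_in_additive : zmod_morphism pb_in.
Proof.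
move=> b c; apply: val_inj; rewrite raddfB /=.
by congr pair; rewrite ?subr0 ?raddfB.
Qed.

HB.instance Definition _ := isContinuous.Build _ _ pb_in pb_in_continuous.
HB.instance Definition _ := GRing.isZmodMorphism.Build _ _ pb_in
  pb_in_additive.

Definition pb_pr (p : P) : A' := (val p).1.

Let pb_pr_continuous : continuous pb_pr.
Proof.
exact: (continuous_o (@continuous_fst _ _) (@tsub_val_continuous _ pb_rel)).
Qed.

Let pb_pr_additive : zmod_morphism pb_pr.
Proof. by move=> p q; rewrite /pb_pr raddfB. Qed.

HB.instance Definition _ := isContinuous.Build _ _ pb_pr pb_pr_continuous.
HB.instance Definition _ := GRing.isZmodMorphism.Build _ _ pb_pr
  pb_pr_additive.

Let pb_pr_surj a : exists p, pb_pr p = a.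
Proof.
have [x xa] := ext_pr_surj E (h a).
have Pax : (a, x) \in pb_rel by rewrite inE /= xa.
by exists (exist _ (a, x) Pax).
Qed.

Let pb_pr_open U : open U -> open (pb_pr @` U).
Proof.
move: U; apply/open_mapP => p U /tsub_nbhs[W [[V1 V2] /= [V1p V2p] VW] WU].
have prV := (open_mapP (ext_pr E)).1 (@ext_pr_open _ _ E) _ _ V2p.
have hV : nbhs (val p).1 (h @^-1` (ext_pr E @` V2)).
  have hp : h (val p).1 = ext_pr E (val p).2 := eqP (valP p).
  by apply: (@cts_fun _ _ h); move: prV; rewrite -hp.
apply: filterS (filterI V1p hV) => a [V1a [x V2x xa]].
have Pax : (a, x) \in pb_rel by rewrite inE /= xa.
by exists (exist _ (a, x) Pax) => //; apply: WU; exact: (VW (a, x)).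
Qed.

Let pb_in_inj : injective pb_in.
Proof. by move=> b c /(congr1 val)[] /ext_in_inj. Qed.

Let pb_in_embed : open = wopen pb_in.
Proof.
apply/open_wopenP => [|b U Ub]; first exact: cts_fun.
have [W Wb WU] :=
  @ext_in_nbhs _ _ E b U Ub.
exists ((fun p : P => (val p).2) @^-1` W); last by [].
apply: (continuous_o (@continuous_snd _ _) (@tsub_val_continuous _ pb_rel)).
exact: Wb.
Qed.

Let pb_exact : range pb_in = pb_pr @^-1` [set 0].
Proof.
apply/seteqP; split=> [_ [b _ <-]//|[[a x] Pax]] /= a0.
have : ext_pr E x = 0.
  have hx : h a = ext_pr E x := eqP Pax.
  by rewrite -hx -(raddf0 h) -a0.
move=> /ext_pr_eq0P[b bx]; exists b => //; apply: val_inj => /=.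
by rewrite bx; congr pair; rewrite -a0.
Qed.

Definition pullback : extension A' B :=
  Extension pb_pr_surj pb_pr_open pb_in_inj pb_in_embed pb_exact.

End pullback.


Section diagonal_codiagonal.
Variable G : topologicalZmodType.

Definition diagonal_map (x : G) : tprod G G := (x, x).

Let diagonal_map_continuous : continuous diagonal_map.
Proof. by apply: continuous_pair => ?; exact: cvg_id. Qed.

Let diagonal_map_additive : zmod_morphism diagonal_map.
Proof. by []. Qed.

HB.instance Definition _ := isContinuous.Build _ _ diagonal_map
  diagonal_map_continuous.
HB.instance Definition _ := GRing.isZmodMorphism.Build _ _ diagonal_map
  diagonal_map_additive.

Definition codiagonal_map (p : tprod G G) : G := p.1 + p.2.

Let codiagonal_map_continuous : continuous codiagonal_map.
Proof. exact: add_continuous. Qed.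

Let codiagonal_map_additive : zmod_morphism codiagonal_map.
Proof. by move=> p q; rewrite /codiagonal_map opprD addrACA. Qed.

HB.instance Definition _ := isContinuous.Build _ _ codiagonal_map
  codiagonal_map_continuous.
HB.instance Definition _ := GRing.isZmodMorphism.Build _ _ codiagonal_map
  codiagonal_map_additive.

End diagonal_codiagonal.

Lemma ext_prod_split (A B A' B' : topologicalZmodType)
    (E : extension A B) (E' : extension A' B') :
  (exists s, @pointed_section _ _ E s) ->
  (exists s, @pointed_section _ _ E' s) ->
  exists s, @pointed_section _ _ (ext_prod E E') s.
Proof.
move=> [s [cs ss s0]] [s' [cs' ss' s'0]].
exists (fun a => (s a.1, s' a.2)); split.
- apply: (@continuous_pair _ _ _ (fun p : A * A' => s p.1) (fun p => s' p.2)).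
    exact: (continuous_o cs (@continuous_fst _ _)).
  exact: (continuous_o cs' (@continuous_snd _ _)).
- by move=> [a a']; congr pair; [exact: ss|exact: ss'].
- by congr pair.
Qed.

Lemma pushout_split (A B B' : topologicalZmodType) (E : extension A B)
    (g : contAdditiveType B B') :
  (exists s, @pointed_section _ _ E s) ->
  exists s, @pointed_section _ _ (pushout E g) s.
Proof.
move=> [s [cs ss s0]].
exists (fun a => \pi_(tquot (@po_rel _ _ _ E g)) (0, s a)); split.
- apply: (@continuous_o _ _ _
    (\pi_(tquot (@po_rel _ _ _ E g)) : tprod B' (ext_mid E) -> tquot (@po_rel _ _ _ E g))
    (fun a => (0, s a))); first exact: tquot_pi_continuous.
  by apply: continuous_pair; [move=> ?; exact: cvg_cst|exact: cs].
- by move=> a; rewrite /= po_prE; exact: ss.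
- by rewrite s0; exact: (raddf0 (@po_in _ _ _ E g)).
Qed.

Lemma pullback_split (A A' B : topologicalZmodType) (E : extension A B)
    (h : contAdditiveType A' A) :
  (exists s, @pointed_section _ _ E s) ->
  exists s, @pointed_section _ _ (pullback E h) s.
Proof.
move=> [s [cs ss s0]].
have Ps a : (a, s (h a)) \in @pb_rel _ _ _ E h by rewrite inE /= ss.
exists (fun a => exist _ (a, s (h a)) (Ps a)); split => //.
- apply: continuous_tsub; apply: continuous_pair; first by move=> ?; exact: cvg_id.
  exact: (continuous_o cs (@cts_fun _ _ h)).
- by apply: val_inj; congr pair; rewrite raddf0.
Qed.

Section baer_sum.
Variables A B : topologicalZmodType.

Definition baer_ext (E F : extension A B) : extension A B :=
  pullback (pushout (ext_prod E F) (@codiagonal_map B)) (@diagonal_map A).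

Lemma baer_ext_split (E F : ws_extension A B) :
  exists s, @pointed_section _ _ (baer_ext E F) s.
Proof.
by apply/pullback_split/pushout_split/ext_prod_split; exact: ws_split.
Qed.

Definition ws_baer (E F : ws_extension A B) : ws_extension A B :=
  WsExtension (baer_ext_split E F).

(* Computed on chosen representatives; that the class does not depend on this
   choice is not part of the definition. *)
Definition baer_sum (c d : Ews A B) : Ews A B :=
  ws_class (ws_baer (ws_repr c) (ws_repr d)).

End baer_sum.

Section cocycles.
Variables A B : topologicalZmodType.

Definition cocycle : {pred A * A -> B} := [pred f : A * A -> B | `[<
  [/\ continuous f, f (0, 0) = 0,
      forall a a', f (a, a') = f (a', a)
    & forall a a' a'',
        f (a, a') + f (a + a', a'') = f (a, a' + a'') + f (a', a'')] >] ].

Let cocycle_zmod_closed : zmod_closed cocycle.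
Proof.
split=> [|f g /asboolP[cf f0 fC fD] /asboolP[cg g0 gC gD]]; apply/asboolP.
  by split=> // ?; exact: cvg_cst.
have fgE p : (f - g) p = f p - g p by [].
split.
- exact: (continuousB cf cg).
- by rewrite fgE f0 g0 subr0.
- by move=> a a'; rewrite !fgE fC gC.
- by move=> a a' a''; rewrite !fgE addrACA -opprD fD gD opprD addrACA.
Qed.

HB.instance Definition _ := GRing.isZmodClosed.Build _ cocycle
  cocycle_zmod_closed.

Definition Zc : Type := {f : A * A -> B | f \in cocycle}.

HB.instance Definition _ := SubChoice.on Zc.
HB.instance Definition _ := [SubChoice_isSubZmodule of Zc by <:].

Definition coboundary : {pred Zc} := [pred f : Zc | `[<
  exists h : A -> B, [/\ continuous h, h 0 = 0
    & forall a a', val f (a, a') = h a + h a' - h (a + a')] >] ].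

Let coboundary_zmod_closed : zmod_closed coboundary.
Proof.
split=> [|f g /asboolP[h [ch h0 fh]] /asboolP[k [ck k0 gk]]]; apply/asboolP.
  exists (fun=> 0); split=> // [?|a a']; first exact: cvg_cst.
  by rewrite addr0 subr0.
exists (fun a => h a - k a); split.
- exact: continuousB.
- by rewrite h0 k0 subr0.
- move=> a a'; rewrite raddfB -[LHS]/(val f (a, a') - val g (a, a')) fh gk.
  by rewrite [h a - k a + _]addrACA !opprD [LHS]addrACA.
Qed.

HB.instance Definition _ := GRing.isZmodClosed.Build _ coboundary
  coboundary_zmod_closed.

End cocycles.

Notation ZcBc A B := (Quotient.quot (@coboundary A B)).

Section factor_set.
Variables (A B : topologicalZmodType) (E : ws_extension A B).
Variable s : A -> ext_mid E.

(* For a section s the set below is a singleton, namely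
   ext_in^-1 (x - s (ext_pr x)); 0 is a default value. *)
Definition ws_retract (x : ext_mid E) : B :=
  xget 0 [set b | ext_in E b = x - s (ext_pr E x)].

Definition factor_set (p : A * A) : B :=
  ws_retract (s p.1 + s p.2 - s (p.1 + p.2)).

End factor_set.

(* Main.v *)
(** A continuous section [s] of [X -> A] splits [X] topologically as [B x A],
    and the sum of [X] is then twisted by the factor set of [s], a symmetric
    2-cocycle.  A morphism of extensions carries a section to a section with the
    same factor set, and two sections of one extension have factor sets
    differing by the coboundary of their difference, so the class of the cocycle
    is an invariant of the equivalence class.  Conversely, cohomologous factor
    sets give a morphism of extensions, and every cocycle is the factor set of
    the group [B x A] with the twisted sum.  The factor set of the Baer sum is
    the sum of the factor sets; the group laws on classes of extensions and the
    independence of the Baer sum from representatives follow by transport along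
    this bijection. *)
Require Import Defs.
From HB Require Import structures.
From Stdlib Require Import Relation_Operators.
From mathcomp Require Import all_boot all_algebra all_classical all_reals.
From mathcomp Require Import topology tvs.

Set Implicit Arguments.
Unset Strict Implicit.
Unset Printing Implicit Defensive.

Import GRing.Theory.
Local Open Scope classical_set_scope.
Local Open Scope ring_scope.
Local Open Scope quotient_scope.

Lemma tquot_piD (G : topologicalZmodType) (N : zmodClosed G) :
  {morph (\pi_(tquot N) : G -> tquot N) : x y / x + y}.
Proof. by move=> x y; exact: (raddfD (\pi_(Quotient.quot N))). Qed.

(** * Retraction and factor set of a pointed section *)

Section factor_set_theory.
Variables (A B : topologicalZmodType) (E : ws_extension A B).

(** [B] has the topology induced by [ext_in], so continuity can be tested in the middle group, where
    retractions and factor sets have explicit formulas. *)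
Lemma continuous_ext_in (T : topologicalType) (g : T -> B) :
  continuous (fun x => ext_in E (g x)) -> continuous g.
Proof.
move=> cg x V /(@ext_in_nbhs _ _ E)[W Wx WV].
by apply: (@filterS _ (nbhs x) _ _ _ _ (cg x W Wx)) => y; exact: WV.
Qed.

(** The element [x - s (ext_pr E x)] projects to 0, so by exactness the default value in
    [ws_retract] is never taken. *)
Lemma ws_retractK (s : A -> ext_mid E) : cancel s (ext_pr E) ->
  forall x, ext_in E (ws_retract s x) = x - s (ext_pr E x).
Proof.
move=> sK x; apply: (@xgetPex _ 0 [set b | ext_in E b = x - s (ext_pr E x)]).
by apply/ext_pr_eq0P; rewrite raddfB /= sK subrr.
Qed.

Variable s : A -> ext_mid E.
Hypothesis sP : pointed_section s.

Let cs : continuous s. Proof. by case: sP. Qed.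
Let sK : cancel s (ext_pr E). Proof. by case: sP. Qed.
Let s0 : s 0 = 0. Proof. by case: sP. Qed.

Lemma ws_retract_continuous : continuous (ws_retract s).
Proof.
apply: continuous_ext_in; under eq_fun do rewrite (ws_retractK sK).
apply: continuousB; first by move=> ?; exact: cvg_id.
exact: (continuous_o cs (@cts_fun _ _ (ext_pr E))).
Qed.

Lemma ws_retract_in b : ws_retract s (ext_in E b) = b.
Proof.
by apply: (@ext_in_inj _ _ E); rewrite (ws_retractK sK) ext_pr_in s0 subr0.
Qed.

Lemma ext_in_factor_set p :
  ext_in E (factor_set s p) = s p.1 + s p.2 - s (p.1 + p.2).
Proof.
by rewrite /factor_set (ws_retractK sK) raddfB raddfD /= !sK subrr s0 subr0.
Qed.

(** By injectivity of [ext_in]; later factor sets are computed through this criterion, without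
    unfolding the retraction. *)
Lemma factor_set_uniq (f : A * A -> B) :
    (forall a a', ext_in E (f (a, a')) = s a + s a' - s (a + a')) ->
  factor_set s = f.
Proof.
move=> fE; apply/funext => -[a a']; apply: (@ext_in_inj _ _ E).
by rewrite ext_in_factor_set fE.
Qed.

Lemma factor_set_cocycle : factor_set s \in @cocycle A B.
Proof.
apply/asboolP; split.
- apply: continuous_ext_in; under eq_fun do rewrite ext_in_factor_set.
  have c1 : continuous (fun p : A * A => s p.1).
    exact: (continuous_o cs (@continuous_fst _ _)).
  have c2 : continuous (fun p : A * A => s p.2).
    exact: (continuous_o cs (@continuous_snd _ _)).
  apply: continuousB; first exact: continuousD.
  exact: (continuous_o cs (@add_continuous A)).
- apply: (@ext_in_inj _ _ E); rewrite ext_in_factor_set /= addr0 s0.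
  by rewrite !subr0 addr0 raddf0.
- move=> a a'; apply: (@ext_in_inj _ _ E).
  by rewrite !ext_in_factor_set /= addrC [a + a']addrC [s a + _]addrC addrC.
- move=> a a' a''; apply: (@ext_in_inj _ _ E).
  rewrite !raddfD /= !ext_in_factor_set /= [a + (a' + a'')]addrA.
  move: (s a) (s a') (s a'') (s (a + a')) (s (a' + a'')) (s (a + a' + a'')).
  move=> x y w z u v.
  (* Both sides telescope to [x + y + w - v]. *)
  rewrite -[z + w - v]addrA subrKA [RHS]addrC [x + u]addrC -[u + x - v]addrA.
  by rewrite subrKA !addrA [x + y]addrC [y + x + w]addrAC.
Qed.

Definition factor_cocycle : Zc A B := exist _ (factor_set s) factor_set_cocycle.

End factor_set_theory.

(** * Cohomology class of the factor set and morphisms of extensions *)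

Section factor_class.
Variables A B : topologicalZmodType.
Implicit Types E F : ws_extension A B.

Lemma factor_set_section_indep E (s t : A -> ext_mid E) :
    pointed_section s -> pointed_section t ->
  exists h : A -> B, [/\ continuous h, h 0 = 0 & forall a a',
    factor_set s (a, a') - factor_set t (a, a') = h a + h a' - h (a + a')].
Proof.
move=> sP tP; have [cs sK s0] := sP; have [ct tK t0] := tP.
(* The difference [s a - t a] lies in the kernel; reading it in [B] through the retraction of [t]
   makes [h] continuous. *)
pose h a := ws_retract t (s a).
have hE a : ext_in E (h a) = s a - t a by rewrite (ws_retractK tK) sK.
exists h; split.
- exact: (continuous_o (ws_retract_continuous tP) cs).
- by rewrite /h s0 -(raddf0 (ext_in E)) (ws_retract_in tP).
- move=> a a'; apply: (@ext_in_inj _ _ E).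
  rewrite !raddfB raddfD /= !hE !ext_in_factor_set //=.
  rewrite [X in _ = X - _]addrACA -opprD !opprB [LHS]addrACA [RHS]addrACA.
  by rewrite [X in _ + X]addrC.
Qed.

Lemma pi_factor_cocycle E F (s : A -> ext_mid E) (t : A -> ext_mid F)
    (sP : pointed_section s) (tP : pointed_section t) :
  (\pi_(ZcBc A B) (factor_cocycle sP) = \pi_(ZcBc A B) (factor_cocycle tP)) <->
  exists h : A -> B, [/\ continuous h, h 0 = 0 & forall a a',
    factor_set s (a, a') - factor_set t (a, a') = h a + h a' - h (a + a')].
Proof.
split=> [/eqP|hP]; last by apply/eqP; rewrite -Quotient.idealrBE; apply/asboolP.
by rewrite -Quotient.idealrBE => /asboolP.
Qed.

Lemma ext_le_pi_factor_cocycle E F (s : A -> ext_mid E) (t : A -> ext_mid F)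
    (sP : pointed_section s) (tP : pointed_section t) :
  ext_le E F ->
  \pi_(ZcBc A B) (factor_cocycle sP) = \pi_(ZcBc A B) (factor_cocycle tP).
Proof.
move=> [theta [theta_in theta_pr]]; have [cs sK s0] := sP.
have uP : pointed_section (theta \o s).
  split; first exact: (continuous_o (@cts_fun _ _ theta) cs).
  - by move=> a; rewrite theta_pr sK.
  - by rewrite /= s0 raddf0.
apply/pi_factor_cocycle.
have -> : factor_set s = factor_set (theta \o s).
  apply/esym/(factor_set_uniq uP) => a a'.
  by rewrite -theta_in ext_in_factor_set // raddfB raddfD.
exact: factor_set_section_indep.
Qed.

(* The morphism [s a + b |-> t a + b + h a] is additive exactly because
   the two factor sets differ by the coboundary of [h]. *)
Lemma pi_factor_cocycle_ext_le E F (s : A -> ext_mid E) (t : A -> ext_mid F)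
    (sP : pointed_section s) (tP : pointed_section t) :
  \pi_(ZcBc A B) (factor_cocycle sP) = \pi_(ZcBc A B) (factor_cocycle tP) ->
  ext_le E F.
Proof.
move=> /pi_factor_cocycle[h [ch h0 hE]].
have [cs sK s0] := sP; have [ct tK t0] := tP.
pose f x := t (ext_pr E x) + ext_in F (ws_retract s x + h (ext_pr E x)).
have cpr := @cts_fun _ _ (ext_pr E).
have cf : continuous f.
  apply: continuousD; first exact: (continuous_o ct cpr).
  apply: (continuous_o (@cts_fun _ _ (ext_in F))).
  apply: continuousD; first exact: ws_retract_continuous.
  exact: (continuous_o ch cpr).
have fD : {morph f : x y / x + y}.
  move=> x y; rewrite /f.
  set a := ext_pr E x; set a' := ext_pr E y.
  (* The factor set of [s] measures the failure of the retraction to be additive, and [tD] says the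
     same of [t]. *)
  have rD : ws_retract s (x + y) =
      ws_retract s x + ws_retract s y + factor_set s (a, a').
    apply: (@ext_in_inj _ _ E).
    rewrite !raddfD /= ext_in_factor_set // !(ws_retractK sK) raddfD.
    rewrite -/a -/a' /=.
    by rewrite [x - s a + _]addrACA -opprD addrA subrK.
  have tD : t (a + a') = t a + t a' - ext_in F (factor_set t (a, a')).
    by rewrite ext_in_factor_set //= opprB addrCA subrr addr0.
  have fsE : factor_set s (a, a') =
      h a + h a' - h (a + a') + factor_set t (a, a').
    by rewrite -hE subrK.
  have prD : ext_pr E (x + y) = a + a' := raddfD _ _ _.
  have inD u v : ext_in F (u + v) = ext_in F u + ext_in F v := raddfD _ _ _.
  have inN u : ext_in F (- u) = - ext_in F u := raddfN _ _.
  rewrite prD tD rD fsE -[LHS]addrA -inN -inD [RHS]addrACA -inD.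
  (* Both sides now have the form [t a + t a'] plus an image of [ext_in]; what remains is an
     identity in [B]. *)
  congr (_ + ext_in F _).
  rewrite addrC !addrA [X in X - _]addrAC subrK addrK -!addrA; congr (_ + _).
  by rewrite addrCA.
have fB : zmod_morphism f.
  by move=> x y; apply/eqP; rewrite eq_sym subr_eq -fD subrK.
pose theta : contAdditiveType (ext_mid E) (ext_mid F) :=
  HB.pack f (isContinuous.Build _ _ f cf) (GRing.isZmodMorphism.Build _ _ f fB).
exists theta; split=> [b|x]; rewrite /= /f.
  by rewrite ext_pr_in t0 h0 ws_retract_in // add0r addr0.
by rewrite raddfD /= tK ext_pr_in addr0.
Qed.

End factor_class.

(** * The extension defined by a cocycle *)

Section twisted_product.
Variables (A B : topologicalZmodType) (f : Zc A B).

Let fP : [/\ continuous (val f), val f (0, 0) = 0,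
      forall a a', val f (a, a') = val f (a', a)
    & forall a a' a'', val f (a, a') + val f (a + a', a'') =
        val f (a, a' + a'') + val f (a', a'')].
Proof. by case: f => /= g /asboolP. Qed.

Let cf : continuous (val f). Proof. by case: fP. Qed.
Let f00 : val f (0, 0) = 0. Proof. by case: fP. Qed.
Let fC a a' : val f (a, a') = val f (a', a). Proof. by case: fP. Qed.
Let fD a a' a'' : val f (a, a') + val f (a + a', a'') =
  val f (a, a' + a'') + val f (a', a'').
Proof. by case: fP. Qed.
(** The cocycle identity at [(0, 0, a)] reads [f (0, a) = f (0, a) + f (0, a)]. This makes [(0, 0)]
    neutral for the twisted sum. *)
Let f0 a : val f (0, a) = 0.
Proof.
have /eqP := fD 0 0 a; rewrite !add0r f00 add0r -subr_eq subrr eq_sym.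
by move=> /eqP.
Qed.

(* The vacuous [let] makes the type mention [f], so that the group structure
   below can be inferred from it. *)
Definition twisted : Type := let _ := f in (B * A)%type.

HB.instance Definition _ := Topological.copy twisted (B * A)%type.

Definition twisted_add (p q : twisted) : twisted :=
  (p.1 + q.1 + val f (p.2, q.2), p.2 + q.2).
(** The term [- val f (p.2, - p.2)] compensates the cocycle value that appears when [p] is added to
    its opposite. *)
Definition twisted_opp (p : twisted) : twisted :=
  (- p.1 - val f (p.2, - p.2), - p.2).

(** In the [B] coordinate this is exactly the cocycle identity. *)
Let twisted_addA : associative twisted_add.
Proof.
move=> [b a] [c a'] [d a'']; congr pair => /=; last by rewrite addrA.
rewrite !addrA -[LHS]addrA [X in _ + X]addrC -fD !addrA.
by rewrite [b + c + d + _]addrAC.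
Qed.

Let twisted_addC : commutative twisted_add.
Proof.
move=> [b a] [c a']; rewrite /twisted_add /= fC [a + _]addrC.
by rewrite [c + b]addrC.
Qed.

Let twisted_add0 : left_id ((0, 0) : twisted) twisted_add.
Proof. by move=> [b a]; rewrite /twisted_add /= f0 !add0r addr0. Qed.

Let twisted_addN : left_inverse ((0, 0) : twisted) twisted_opp twisted_add.
Proof.
move=> [b a]; rewrite /twisted_add /= addNr fC addrAC subrK.
by rewrite addNr.
Qed.

HB.instance Definition _ := GRing.isZmodule.Build twisted
  twisted_addA twisted_addC twisted_add0 twisted_addN.

Let twisted_sub_continuous :
  continuous (fun p : twisted * twisted => p.1 - p.2).
Proof.
have c11 : continuous (fun p : (B * A) * (B * A) => p.1.1).
  exact: (continuous_o (@continuous_fst B A) (@continuous_fst _ _)).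
have c12 : continuous (fun p : (B * A) * (B * A) => p.1.2).
  exact: (continuous_o (@continuous_snd B A) (@continuous_fst _ _)).
have c21 : continuous (fun p : (B * A) * (B * A) => p.2.1).
  exact: (continuous_o (@continuous_fst B A) (@continuous_snd _ _)).
have c22 : continuous (fun p : (B * A) * (B * A) => p.2.2).
  exact: (continuous_o (@continuous_snd B A) (@continuous_snd _ _)).
have cN : continuous (fun p : (B * A) * (B * A) => - p.2.2).
  exact: (continuous_o (@opp_continuous A) c22).
(* The coordinates of [twisted_add p.1 (twisted_opp p.2)], written out. *)
apply: (@continuous_pair _ _ _ (fun p : (B * A) * (B * A) =>
  p.1.1 + (- p.2.1 - val f (p.2.2, - p.2.2)) + val f (p.1.2, - p.2.2))
  (fun p => p.1.2 - p.2.2)); last exact: continuousB.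
apply: continuousD; last exact: (continuous_o cf (continuous_pair c12 cN)).
apply: continuousD => //; apply: continuousB.
  exact: (continuous_o (@opp_continuous B) c21).
exact: (continuous_o cf (continuous_pair c22 cN)).
Qed.

HB.instance Definition _ :=
  PreTopologicalNmodule_isTopologicalZmodule.Build twisted
    twisted_sub_continuous.

Lemma twistedD (p q : twisted) :
  p + q = (p.1 + q.1 + val f (p.2, q.2), p.2 + q.2).
Proof. by []. Qed.

Definition twisted_in (b : B) : twisted := (b, 0).

Definition twisted_pr (p : twisted) : A := p.2.

Let twisted_in_continuous : continuous twisted_in.
Proof.
by apply: continuous_pair; [move=> ?; exact: cvg_id|move=> ?; exact: cvg_cst].
Qed.

Let twisted_in_additive : zmod_morphism twisted_in.
Proof.
move=> b c; apply/eqP; rewrite eq_sym subr_eq; apply/eqP.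
by rewrite twistedD /= f00 !addr0 subrK.
Qed.

HB.instance Definition _ := isContinuous.Build _ _ twisted_in
  twisted_in_continuous.
HB.instance Definition _ := GRing.isZmodMorphism.Build _ _ twisted_in
  twisted_in_additive.

Let twisted_pr_continuous : continuous twisted_pr.
Proof. exact: (@continuous_snd B A). Qed.

Let twisted_pr_additive : zmod_morphism twisted_pr.
Proof. by []. Qed.

HB.instance Definition _ := isContinuous.Build _ _ twisted_pr
  twisted_pr_continuous.
HB.instance Definition _ := GRing.isZmodMorphism.Build _ _ twisted_pr
  twisted_pr_additive.

Let twisted_pr_surj a : exists p, twisted_pr p = a.
Proof. by exists (0, a). Qed.

Let twisted_pr_open U : open U -> open (twisted_pr @` U).
Proof. exact: (@snd_open B A). Qed.

Let twisted_in_inj : injective twisted_in.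
Proof. by move=> b c []. Qed.

Let twisted_in_embed : open = wopen twisted_in.
Proof.
apply/open_wopenP => [|b U Ub]; first exact: cts_fun.
(* The first projection is a continuous left inverse of [twisted_in]. *)
by exists (fst @^-1` U) => //; exact: (@continuous_fst B A).
Qed.

Let twisted_exact : range twisted_in = twisted_pr @^-1` [set 0].
Proof.
apply/seteqP; split=> [_ [b _ <-]//|[b a] /= a0].
by exists b => //; rewrite /twisted_in -a0.
Qed.

Definition twisted_ext : extension A B :=
  Extension twisted_pr_surj twisted_pr_open twisted_in_inj twisted_in_embed
    twisted_exact.

Definition twisted_section (a : A) : ext_mid twisted_ext := ((0, a) : twisted).

Lemma twisted_section_pointed : pointed_section twisted_section.
Proof.
split=> //; apply: continuous_pair; last by move=> ?; exact: cvg_id.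
by move=> ?; exact: cvg_cst.
Qed.

Definition twisted_ws : ws_extension A B :=
  WsExtension (ex_intro _ _ twisted_section_pointed).

(** In the twisted group, [(0, a) + (0, a')] and [(f (a, a'), 0) + (0, a + a')] both equal
    [(f (a, a'), a + a')]. *)
Lemma factor_set_twisted : @factor_set _ _ twisted_ws twisted_section = val f.
Proof.
apply: (@factor_set_uniq _ _ twisted_ws _ twisted_section_pointed) => a a'.
apply/eqP; rewrite eq_sym subr_eq; apply/eqP.
apply: (etrans (twistedD _ _)); rewrite (twistedD (twisted_in _)) /=.
by rewrite f0 !addr0 !add0r.
Qed.

End twisted_product.

(** * A section of the Baer sum and its factor set *)

Section ws_baer_factor.
Variables (A B : topologicalZmodType) (E F : ws_extension A B).
Variables (s : A -> ext_mid E) (t : A -> ext_mid F).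
Hypotheses (sP : pointed_section s) (tP : pointed_section t).

Local Notation R := (@po_rel _ _ _ (ext_prod E F) (@codiagonal_map B)).
Local Notation piQ := (\pi_(tquot R)).

Lemma ws_baer_section_mem a :
  (a, piQ (0, (s a, t a)))
    \in @pb_rel _ _ _ (pushout (ext_prod E F) (@codiagonal_map B))
      (@diagonal_map A).
Proof.
have [_ sK _] := sP; have [_ tK _] := tP.
rewrite inE; apply/eqP; rewrite /= po_prE.
by rewrite /= /tprod_map /= sK tK.
Qed.

(** The section built in the splitting lemmas for product, pushout and pullback, made explicit
    because those lemmas assert existence only. *)
Definition ws_baer_section (a : A) : ext_mid (ws_baer E F) :=
  exist _ (a, piQ (0, (s a, t a))) (ws_baer_section_mem a).

Lemma ws_baer_section_pointed : pointed_section ws_baer_section.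
Proof.
have [cs sK s0] := sP; have [ct tK t0] := tP.
split=> //.
- apply: continuous_tsub; apply: continuous_pair.
    by move=> ?; exact: cvg_id.
  apply: (@continuous_o _ _ _
    (piQ : tprod B (tprod (ext_mid E) (ext_mid F)) -> tquot R)
    (fun a => (0, (s a, t a)))); first exact: tquot_pi_continuous.
  apply: continuous_pair; first by move=> ?; exact: cvg_cst.
  exact: continuous_pair.
- apply: val_inj; congr pair; rewrite s0 t0.
  exact: (raddf0 (@po_in _ _ _ (ext_prod E F) (@codiagonal_map B))).
Qed.

Lemma factor_set_ws_baer p :
  factor_set ws_baer_section p = factor_set s p + factor_set t p.
Proof.
have -> : factor_set ws_baer_section = fun p => factor_set s p + factor_set t p.
  apply: (factor_set_uniq ws_baer_section_pointed) => a a'.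
  apply: val_inj; rewrite [in RHS]raddfB [in RHS]raddfD /=.
  apply: injective_projections; rewrite /= ?subrr //.
  rewrite -tquot_piD -tquot_piB; apply/tquot_pi_eq/asboolP.
  (* The pushout identifies the image of this pair in the product extension with its codiagonal, the
     sum of the factor sets. *)
  exists (factor_set s (a, a'), factor_set t (a, a')).
  apply: injective_projections; rewrite /= ?addr0 ?subr0 //.
  rewrite sub0r; congr (- _).
  by apply: injective_projections; rewrite /= ext_in_factor_set.
by [].
Qed.

End ws_baer_factor.

(** * The bijection between extension classes and cocycle classes *)

Section class_map.
Variables A B : topologicalZmodType.
Implicit Types E F : ws_extension A B.

Definition section_of E : A -> ext_mid E := projT1 (cid (ws_split E)).

Lemma section_ofP E : pointed_section (section_of E).
Proof. exact: projT2 (cid (ws_split E)). Qed.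

Definition ext_cocycle_class E : ZcBc A B :=
  \pi_(ZcBc A B) (factor_cocycle (section_ofP E)).

(** Independence of the section makes the choice in [section_of] harmless, so a class may be
    computed from any convenient section. *)
Lemma ext_cocycle_classE E (s : A -> ext_mid E) (f : Zc A B) :
  pointed_section s -> val f = factor_set s ->
  ext_cocycle_class E = \pi_(ZcBc A B) f.
Proof.
move=> sP fs; have -> : f = factor_cocycle sP by exact: val_inj.
by apply/pi_factor_cocycle/factor_set_section_indep; [exact: section_ofP|].
Qed.

(** Invariance under morphisms passes to the generated equivalence by induction; conversely, equal
    classes already give a single morphism. *)
Lemma ext_cocycle_classP E F :
  ws_class E = ws_class F <-> ext_cocycle_class E = ext_cocycle_class F.
Proof.
rewrite ws_classP; split.
  elim=> {E F} [E F|//|E F _ ->//|E F G _ -> _ ->//].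
  exact: ext_le_pi_factor_cocycle.
by move=> EF; apply: rst_step; apply: pi_factor_cocycle_ext_le EF.
Qed.

Lemma ext_cocycle_class_baer E F :
  ext_cocycle_class (ws_baer E F) = ext_cocycle_class E + ext_cocycle_class F.
Proof.
have <- : \pi_(ZcBc A B) (factor_cocycle (section_ofP E) +
    factor_cocycle (section_ofP F)) = ext_cocycle_class E + ext_cocycle_class F.
  exact: raddfD.
apply: ext_cocycle_classE.
  exact: ws_baer_section_pointed (section_ofP E) (section_ofP F).
by apply/funext => p; rewrite factor_set_ws_baer raddfD.
Qed.

Definition cocycle_class (c : Ews A B) : ZcBc A B :=
  ext_cocycle_class (ws_repr c).

Lemma cocycle_class_ws_class E :
  cocycle_class (ws_class E) = ext_cocycle_class E.
Proof. by apply/ext_cocycle_classP; exact: ws_reprK. Qed.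

(** The inverse of [cocycle_class]. *)
Definition twisted_class (q : ZcBc A B) : Ews A B :=
  ws_class (twisted_ws (repr q)).

Lemma twisted_classK : cancel twisted_class cocycle_class.
Proof.
move=> q; rewrite /twisted_class cocycle_class_ws_class -[RHS]reprK.
apply: ext_cocycle_classE; first exact: twisted_section_pointed.
by rewrite factor_set_twisted.
Qed.

Lemma cocycle_class_inj : injective cocycle_class.
Proof. by move=> c d /ext_cocycle_classP; rewrite !ws_reprK. Qed.

Lemma cocycle_classK : cancel cocycle_class twisted_class.
Proof. by move=> c; apply: cocycle_class_inj; rewrite twisted_classK. Qed.

Lemma cocycle_classD :
  {morph cocycle_class : c d / baer_sum c d >-> c + d}.
Proof.
by move=> c d; rewrite cocycle_class_ws_class ext_cocycle_class_baer.
Qed.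

End class_map.

Theorem theorem3p2 (A B : topologicalZmodType) :
  [/\ forall E F : ws_extension A B,
         baer_sum (ws_class E) (ws_class F) = ws_class (ws_baer E F),
      exists (zero : Ews A B) (opp : Ews A B -> Ews A B),
        [/\ associative (@baer_sum A B), commutative (@baer_sum A B),
            left_id zero (@baer_sum A B)
          & left_inverse zero opp (@baer_sum A B)],
      forall (E : ws_extension A B) (s : A -> ext_mid E),
        pointed_section s -> factor_set s \in @cocycle A B
    & exists phi : Ews A B -> ZcBc A B,
        [/\ forall (E : ws_extension A B) (s : A -> ext_mid E) (f : Zc A B),
              pointed_section s -> val f = factor_set s ->
              phi (ws_class E) = \pi_(ZcBc A B) f,
            {morph phi : c d / baer_sum c d >-> c + d}
          & bijective phi]].
Proof.
split.
- move=> E F; apply: cocycle_class_inj.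
  by rewrite cocycle_classD !cocycle_class_ws_class ext_cocycle_class_baer.
(* Zero and opposite are transported from the quotient of cocycles; the group laws are then checked
   there by injectivity. *)
- exists (twisted_class 0), (fun c => twisted_class (- cocycle_class c)).
  split=> [c d e|c d|c|c]; apply: cocycle_class_inj; rewrite !cocycle_classD.
  + exact: addrA.
  + exact: addrC.
  + by rewrite twisted_classK add0r.
  + by rewrite !twisted_classK addNr.
- move=> E s; exact: factor_set_cocycle.
- exists (@cocycle_class A B); split.
  + move=> E s f sP fs; rewrite cocycle_class_ws_class.
    exact: ext_cocycle_classE sP fs.
  + exact: cocycle_classD.
  + exact: Bijective (@cocycle_classK A B) (@twisted_classK A B).
Qed.
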